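(* Let $\varSigma=(\mathbb{N},X,U,\mathcal{U},\phi)$ be a discrete-time control system. Let $Q$ be a controlled invariant set, let $\mathcal{C}=(\mathcal{A},\tau,\nu)$ be an invariant partition of $Q$, let $Z$ be a non-empty subset of $Q$, and let $\varphi\in C(U,\mathbb{R})$ with $\varphi>0$. Then the BS invariance dimension ${\rm dim}_{\mathcal{C}}^{BS}(\varphi,Z,Q)$ of $\varphi$ on $Z$ w.r.t. $\mathcal{C}$ is the unique root $t\in\mathbb{R}$ of the equation $$P_{\mathcal{C}}(-t\varphi,Z,Q)=0,$$ where $P_{\mathcal{C}}(f,Z,Q)$ denotes the Pesin-Pitskel invariance pressure of $f\in C(U,\mathbb{R})$ on $Z$ w.r.t. $\mathcal{C}$.
   Context: Control system. $\mathbb{N}=\{0,1,2,\dots\}$. $X$ is a metric space, $U$ is a compact metric space, $F:X\times U\to X$ is a map such that $F_u:=F(\cdot,u):X\to X$ is continuous for each fixed $u\in U$, and $\mathcal{U}$ is a subset of the set of all sequences $\omega=(\omega_k)_{k\in\mathbb{N}}$ in $U$. For a control sequence $\omega$ (infinite, or finite of length at least $k$) put $\phi(k,x,\omega)=F_{\omega_{k-1}}\circ\cdots\circ F_{\omega_0}(x)$, $\phi(0,x,\omega)=x$. The tuple $\varSigma=(\mathbb{N},X,U,\mathcal{U},\phi)$ is called a discrete-time control system. $C(U,\mathbb{R})$ is the set of continuous real functions on $U$. Controlled invariant set. A non-empty compact set $Q\subset X$ such that for every $x\in Q$ there is $\omega_x\in\mathcal{U}$ with $\phi(n,x,\omega_x)\in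 Q$ for all $n\in\mathbb{N}$. Invariant partition. A triple $\mathcal{C}=(\mathcal{A},\tau,\nu)$ where $\mathcal{A}=\{A_1,\dots,A_q\}$ is a finite Borel partition of $Q$, $\tau\geq 1$ is an integer, and $\nu:\mathcal{A}\to U^\tau$ is a map such that $\phi(j,A_i,\nu(A_i))\subset Q$ for all $1\le i\le q$ and all integers $0\le j\le\tau$. Put $S=\{1,\dots,q\}$, $\omega_i:=\nu(A_i)$, and for a finite or infinite word $s=(s_0,s_1,\dots)$ over $S$ let $\omega_s=\omega_{s_0}\omega_{s_1}\cdots$ be the concatenation (of length $n\tau$ if $s$ has length $n$). For every $x\in Q$ there is a unique $\mathcal{C}(x)=(\mathcal{C}_j(x))_{j\in\mathbb{N}}\in S^{\mathbb{N}}$ with $\phi(j\tau,x,\omega_{\mathcal{C}(x)})\in A_{\mathcal{C}_j(x)}$ for every $j\in\mathbb{N}$. Write $\mathcal{C}_{[0,n)}(x)=(\mathcal{C}_0(x),\dots,\mathcal{C}_{n-1}(x))$; so $\omega_{\mathcal{C}_{[0,n)}(x)}\in U^{n\tau}$. The cylindrical set of $x\in Q$ of length $n$ is $Q_n(x,\mathcal{C})=\{y\in Q:\mathcal{C}_j(y)=\mathcal{C}_j(x),\ j=0,\dots,n-1\}$. For $\omega=(\omega_0,\dots,\omega_{n-1})\in U^n$ and $f\in C(U,\mathbb{R})$ put $S_nf(\omega)=\sum_{j=0}^{n-1}f(\omega_j)$. In the following, for $N\in\mathbb{N}$, the infima are taken over all finite or countable families $\{Q_{n_i}(x_i,\mathcal{C})\}_{i\in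 I}$ with $x_i\in Q$, $n_i\ge N$ and $\bigcup_{i\in I}Q_{n_i}(x_i,\mathcal{C})\supset Z$. Pesin-Pitskel invariance pressure. For $f\in C(U,\mathbb{R})$, $\lambda\in\mathbb{R}$, $$M_{\mathcal{C}}(f,Z,Q,\lambda,N)=\inf\Big\{\sum_{i\in I}e^{-\lambda n_i\tau+S_{n_i\tau}f(\omega_{\mathcal{C}_{[0,n_i)}(x_i)})}\Big\},\quad M_{\mathcal{C}}(f,Z,Q,\lambda)=\lim_{N\to\infty}M_{\mathcal{C}}(f,Z,Q,\lambda,N)$$ (the limit is monotone), and $$P_{\mathcal{C}}(f,Z,Q)=\inf\{\lambda: M_{\mathcal{C}}(f,Z,Q,\lambda)=0\}=\sup\{\lambda: M_{\mathcal{C}}(f,Z,Q,\lambda)=\infty\}.$$ BS invariance dimension. For $\varphi\in C(U,\mathbb{R})$ with $\varphi>0$, $\lambda\in\mathbb{R}$, $$R_{\mathcal{C}}(\varphi,Z,Q,\lambda,N)=\inf\Big\{\sum_{i\in I}e^{-\lambda S_{n_i\tau}\varphi(\omega_{\mathcal{C}_{[0,n_i)}(x_i)})}\Big\},\quad R_{\mathcal{C}}(\varphi,Z,Q,\lambda)=\lim_{N\to\infty}R_{\mathcal{C}}(\varphi,Z,Q,\lambda,N),$$ $${\rm dim}_{\mathcal{C}}^{BS}(\varphi,Z,Q)=\inf\{\lambda: R_{\mathcal{C}}(\varphi,Z,Q,\lambda)=0\}=\sup\{\lambda: R_{\mathcal{C}}(\varphi,Z,Q,\lambda)=\infty\}.$$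 *)

(* Defs.v *)
From HB Require Import structures.
From mathcomp Require Import all_boot all_order all_algebra.
From mathcomp Require Import all_classical all_reals all_analysis.

Set Implicit Arguments.
Unset Strict Implicit.
Unset Printing Implicit Defensive.

Import Order.TTheory GRing.Theory Num.Theory.
Import numFieldNormedType.Exports.

Local Open Scope classical_set_scope.
Local Open Scope ring_scope.

(* phi(k, x, w) for a finite control word w of length at least k. *)
Definition flow_word (X U : Type) (F : X -> U -> X) (k : nat) (x : X)
    (w : seq U) : X :=
  foldl F x (take k w).

(* phi(k, x, omega) for an infinite control sequence omega. *)
Definition flow (X U : Type) (F : X -> U -> X) (k : nat) (x : X)
    (omega : nat -> U) : X :=
  foldl F x (mkseq omega k).

Definition controlled_invariant (R : realType) (X U : metricType R)
    (F : X -> U -> X) (UU : set (nat -> U)) (Q : set X) : Prop :=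
  [/\ Q !=set0, compact Q &
      forall x, Q x ->
        exists2 omega, UU omega & forall n, Q (flow F n x omega)].

(* The blocks are indexed by 'I_(ip_q.+1); there is at least one of them
   because a controlled invariant set is non-empty. They are pairwise disjoint
   and non-empty, so a map on indices is the same as a map on blocks. *)
Record invariant_partition (R : realType) (X U : metricType R)
    (F : X -> U -> X) (Q : set X) := InvariantPartition {
  ip_q : nat;
  ip_block : 'I_ip_q.+1 -> set X;
  ip_tau : nat;
  ip_nu : 'I_ip_q.+1 -> ip_tau.-tuple U;
  ip_partition : partition [set: 'I_ip_q.+1] ip_block Q;
  ip_borel : forall i, <<s [set O : set X | open O] >> (ip_block i);
  ip_tau_gt0 : (0 < ip_tau)%N;
  ip_invariant : forall i j, (j <= ip_tau)%N ->
    [set flow_word F j x (ip_nu i) | x in ip_block i] `<=` Q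
}.
Arguments ip_block {R X U F Q} C : rename.
Arguments ip_nu {R X U F Q} C : rename.

Section Partition.
Variables (R : realType) (X U : metricType R) (F : X -> U -> X) (Q : set X).
Variable C : invariant_partition F Q.

Local Notation S := 'I_(ip_q C).+1.
Local Notation tau := (ip_tau C).

(* omega_s for a finite word s. *)
Definition concat_word (s : seq S) : seq U :=
  flatten [seq tval (ip_nu C i) | i <- s].

(* omega_s for an infinite word s: its k-th letter is letter k mod tau of the
   block omega_(s_(k div tau)). *)
Definition concat_seq (s : nat -> S) (k : nat) : U :=
  tnth (ip_nu C (s (k %/ tau)%N)) (Ordinal (ltn_pmod k (ip_tau_gt0 C))).

Definition is_itinerary (x : X) (s : nat -> S) : Prop :=
  forall j, ip_block C (s j) (flow F (j * tau) x (concat_seq s)).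

(* The sequence C(x); the default value is never used for x in Q, see
   itinerary_unique below. *)
Definition itinerary (x : X) : nat -> S :=
  xget (fun=> ord0) [set s | is_itinerary x s].

(* omega_(C_[0,n)(x)), of length n * tau. *)
Definition itinerary_control (x : X) (n : nat) : seq U :=
  concat_word (mkseq (itinerary x) n).

Definition cylinder (n : nat) (x : X) : set X :=
  [set y | Q y /\ forall j, (j < n)%N -> itinerary y j = itinerary x j].

(* The infimum of \sum_(i in I) e^(w x_i n_i) over all finite or countable
   families of cylinders Q_(n_i)(x_i) with x_i in Q and n_i >= N that cover Z.
   Any such family can be indexed by a subset I of nat. *)
Definition cover_inf (w : X -> nat -> R) (Z : set X) (N : nat) : \bar R :=
  ereal_inf [set t : \bar R |
    exists (I : set nat) (x : nat -> X) (n : nat -> nat),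
      [/\ forall i, I i -> Q (x i) /\ (N <= n i)%N,
          Z `<=` \bigcup_(i in I) cylinder (n i) (x i) &
          t = \esum_(i in I) (expR (w (x i) (n i)))%:E]].

(* S_n f(w), where n is the length of w. *)
Definition birkhoff_sum (f : U -> R) (w : seq U) : R := \sum_(u <- w) f u.

Definition pressure_mass_at (f : U -> R) (Z : set X) (lambda : R) (N : nat)
    : \bar R :=
  cover_inf (fun x n => - lambda * (n * tau)%:R
                        + birkhoff_sum f (itinerary_control x n)) Z N.

Definition pressure_mass (f : U -> R) (Z : set X) (lambda : R) : \bar R :=
  limn (pressure_mass_at f Z lambda).

Definition pressure (f : U -> R) (Z : set X) : \bar R :=
  ereal_inf [set lambda%:E | lambda in
    [set lambda : R | pressure_mass f Z lambda = 0%E]].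

Definition bs_mass_at (phi : U -> R) (Z : set X) (lambda : R) (N : nat)
    : \bar R :=
  cover_inf (fun x n =>
    - lambda * birkhoff_sum phi (itinerary_control x n)) Z N.

Definition bs_mass (phi : U -> R) (Z : set X) (lambda : R) : \bar R :=
  limn (bs_mass_at phi Z lambda).

Definition bs_dimension (phi : U -> R) (Z : set X) : \bar R :=
  ereal_inf [set lambda%:E | lambda in
    [set lambda : R | bs_mass phi Z lambda = 0%E]].

Definition block_of (x : X) : S := xget ord0 [set i | ip_block C i x].

Lemma block_ofP x : Q x -> ip_block C (block_of x) x.
Proof.
move=> Qx; have [cQ _ _] := ip_partition C.
have [i _ Aix] : cover [set: S] (ip_block C) x by rewrite cQ.
by apply: (@xgetPex _ ord0 [set i | ip_block C i x]); exists i.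
Qed.

Lemma block_inj x i j : ip_block C i x -> ip_block C j x -> i = j :> S.
Proof.
have [_ tQ _] := ip_partition C => Ai Aj.
by apply: (tQ i j) => //; exists x.
Qed.

Lemma flowD k l x (omega : nat -> U) :
  flow F (k + l) x omega = flow F l (flow F k x omega) (fun n => omega (k + n)%N).
Proof.
rewrite /flow -foldl_cat; congr foldl; rewrite /mkseq iotaD map_cat; congr cat.
by rewrite add0n -[in LHS](addn0 k) iotaDl -map_comp.
Qed.

Lemma flow_step j x s : flow F (j.+1 * tau) x (concat_seq s)
  = foldl F (flow F (j * tau) x (concat_seq s)) (ip_nu C (s j)).
Proof.
rewrite mulSn addnC flowD /flow; congr foldl.
apply: (@eq_from_nth _ (concat_seq s 0)).
  by rewrite size_mkseq size_tuple.
move=> i; rewrite size_mkseq => ilt; rewrite nth_mkseq// /concat_seq.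
have E : ((j * tau + i) %/ tau)%N = j.
  by rewrite divnMDl ?(ip_tau_gt0 C)// divn_small ?addn0.
rewrite E (tnth_nth (concat_seq s 0)) /=.
by rewrite modnMDl modn_small.
Qed.

Lemma itinerary_unique x : Q x ->
  is_itinerary x (itinerary x) /\
  forall s, is_itinerary x s -> s = itinerary x.
Proof.
move=> Qx.
pose st j := iter j (fun y => foldl F y (ip_nu C (block_of y))) x.
have Qst j : Q (st j).
  elim: j => //= j IH; apply: (@ip_invariant _ _ _ _ _ C (block_of (st j)) tau) => //.
  exists (st j); first exact: block_ofP.
  by rewrite /flow_word take_oversize // size_tuple.
pose s0 j := block_of (st j).
have F0 j : flow F (j * tau) x (concat_seq s0) = st j.
  elim: j => [|j IH]; first by rewrite mul0n.
  by rewrite flow_step IH.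
have I0 : is_itinerary x s0 by move=> j; rewrite F0; exact: block_ofP.
have uniq s : is_itinerary x s -> s = s0.
  move=> Is; have Fs j : flow F (j * tau) x (concat_seq s) = st j.
    elim: j => [|j IH]; first by rewrite mul0n.
    rewrite flow_step IH /=; congr (foldl F _ (tval (ip_nu C _))).
    apply: (@block_inj (st j)); last exact: block_ofP.
    by rewrite -IH.
  apply/funext => j; apply: (@block_inj (st j)); last exact: block_ofP.
  by rewrite -Fs.
have Iit : is_itinerary x (itinerary x).
  by apply: (@xgetPex _ (fun=> ord0) [set s | is_itinerary x s]); exists s0.
by split=> // s /uniq ->; rewrite [RHS]uniq.
Qed.

End Partition.

(* Main.v *)
(* For the potential - t phi, both masses are limits of one covering infimum,
   with weights exp(- lambda n tau - t S phi): the pressure takes the critical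
   lambda at fixed t, the dimension the critical t at lambda = 0. There are
   finitely many control blocks, so S phi lies between m n and M n with
   0 < m <= M. Hence a shift of t can be traded for a proportional shift of
   lambda without increasing any weight, and the critical curve in the
   (t, lambda) plane is strictly decreasing and continuous; it crosses
   lambda = 0 exactly at the dimension. The dimension is finite because all
   weights are at least 1 for t <= 0, whereas the cylinders of length n, of
   which there are at most q^n for q blocks, have total weight at most 2^-n
   when t = ln (2q) / m. *)
Require Import Defs.
From mathcomp Require Import all_boot all_order all_algebra.
From mathcomp Require Import all_classical all_reals all_analysis.
From mathcomp Require Import ring lra.

Set Implicit Arguments.
Unset Strict Implicit.
Unset Printing Implicit Defensive.

Import Order.TTheory GRing.Theory Num.Theory.
Import numFieldNormedType.Exports.

Local Open Scope classical_set_scope.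
Local Open Scope ring_scope.

(** * Covering infima for an arbitrary weight *)

Section CoverInf.
Variables (R : realType) (X U : metricType R) (F : X -> U -> X) (Q : set X).
Variable C : invariant_partition F Q.

Implicit Types (w : X -> nat -> R) (Z : set X).

Lemma cover_inf_ge0 w Z N : (0 <= cover_inf C w Z N)%E.
Proof.
apply/ereal_infP => _ [I [x [n [_ _ ->]]]].
by apply: esum_ge0 => i _; rewrite lee_fin expR_ge0.
Qed.

(** A point of [Z] lies in some cylinder of each cover, and the term of that cylinder alone is at
    least exp 0. *)
Lemma cover_inf_ge1 w Z N : Z !=set0 -> (forall x n, 0 <= w x n) ->
  (1 <= cover_inf C w Z N)%E.
Proof.
move=> [z Zz] w0; apply/ereal_infP => _ [I [x [n [_ Zcov ->]]]].
have [i Ii _] := Zcov _ Zz.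
apply: esum_ge; exists [set i].
  by split; [exact: finite_set1 | move=> _ ->].
by rewrite fsbig_set1 lee_fin -expR0 ler_expR.
Qed.

Lemma le_cover_inf w w' Z N : (forall x n, w' x n <= w x n) ->
  (cover_inf C w' Z N <= cover_inf C w Z N)%E.
Proof.
move=> ww'; apply/ereal_infP => _ [I [x [n [IQ Zcov ->]]]].
apply: ge_ereal_inf; exists (\esum_(i in I) (expR (w' (x i) (n i)))%:E)%E.
  by exists I, x, n.
by apply: le_esum => i _; rewrite lee_fin ler_expR.
Qed.

Lemma cover_inf_nondecreasing w Z :
  {homo cover_inf C w Z : N M / (N <= M)%N >-> (N <= M)%E}.
Proof.
move=> N M NM; apply: ereal_inf_le_tmp => _ [I [x [n [IQ Zcov ->]]]].
exists I, x, n; split=> // i /IQ[Qx Mn]; split=> //; exact: leq_trans Mn.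
Qed.

(** The infimum is non-negative and nondecreasing in [N], so its limit is its supremum; this trades
    the limit for one inequality per [N]. *)
Lemma lim_cover_inf_eq0 w Z :
  limn (cover_inf C w Z) = 0%E <-> forall N, (cover_inf C w Z N <= 0)%E.
Proof.
have cvg := ereal_nondecreasing_cvgn (cover_inf_nondecreasing w Z).
rewrite (cvg_lim _ cvg)//; split=> [sup0 N|le0].
  by rewrite -sup0; apply: ereal_sup_ubound; exists N.
apply/eqP; rewrite eq_le; apply/andP; split.
  by apply: ge_ereal_sup => _ [N _ <-].
by apply: le_trans (cover_inf_ge0 w Z 0) _; apply: ereal_sup_ubound; exists 0%N.
Qed.

Lemma le_lim_cover_inf_eq0 w w' Z : (forall x n, w' x n <= w x n) ->
  limn (cover_inf C w Z) = 0%E -> limn (cover_inf C w' Z) = 0%E.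
Proof.
move=> ww' /lim_cover_inf_eq0 w0; apply/lim_cover_inf_eq0 => N.
exact: le_trans (le_cover_inf _ _ ww') (w0 N).
Qed.

(* One cylinder of length n for each word of length n over the ip_q.+1 blocks
   is enough to cover Z. *)
Lemma cover_inf_le_card w Z N n c : Z !=set0 -> Z `<=` Q -> (N <= n)%N ->
  (forall x, w x n <= c) ->
  (cover_inf C w Z N <= (((ip_q C).+1 ^ n)%:R * expR c)%:E)%E.
Proof.
move=> [z Zz] ZQ Nn wc.
pose T := {ffun 'I_n -> 'I_(ip_q C).+1}.
pose code x : nat := enum_rank ([ffun j : 'I_n => itinerary C x j] : T).
(* Some words may be realized by no point of [Q]; the default [z] keeps [x i] in [Q] for them
   too. *)
pose x i := xget z [set y | Q y /\ code y = i].
have Qx i : Q (x i).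
  by rewrite /x; case: xgetP => [y -> [] //|_]; exact: ZQ.
apply: ge_ereal_inf.
exists (\esum_(i in `I_#|T|) (expR (w (x i) n))%:E)%E.
  exists `I_#|T|, x, (fun=> n); split=> // y Zy.
  exists (code y); first exact: ltn_ord.
  have [_ cxy] : [set y' | Q y' /\ code y' = code y] (x (code y)).
    apply: (@xgetPex _ z [set y' | Q y' /\ code y' = code y]).
    by exists y; split=> //; exact: ZQ.
  split; first exact: ZQ.
  move=> j jn; have /enum_rank_inj/ffunP/(_ (Ordinal jn)) := val_inj cxy.
  by rewrite !ffunE.
rewrite esum_fset; [|exact: finite_II|by move=> i _; rewrite lee_fin expR_ge0].
rewrite -fsbig_ord sumEFin lee_fin.
have -> : ((ip_q C).+1 ^ n)%N = #|T| by rewrite card_ffun !card_ord.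
rewrite mulr_natl -[in leRHS](card_ord #|T|) -sumr_const.
by apply: ler_sum => i _; rewrite ler_expR.
Qed.

End CoverInf.

(** * Birkhoff sums along itineraries *)

Section BirkhoffSum.
Variables (R : realType) (X U : metricType R) (F : X -> U -> X) (Q : set X).
Variable C : invariant_partition F Q.

Lemma birkhoff_sumZ (a : R) (f : U -> R) s :
  birkhoff_sum (fun u => a * f u) s = a * birkhoff_sum f s.
Proof. by rewrite /birkhoff_sum mulr_sumr. Qed.

Lemma birkhoff_itinerary (f : U -> R) x n :
  birkhoff_sum f (itinerary_control C x n) =
  \sum_(j < n) birkhoff_sum f (ip_nu C (itinerary C x j)).
Proof.
rewrite /birkhoff_sum /itinerary_control /concat_word big_flatten big_map.
by rewrite /mkseq big_map -{1}(subn0 n) -/(index_iota 0 n) big_mkord.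
Qed.

Lemma birkhoff_itinerary_bounds (f : U -> R) : (forall u, 0 < f u) ->
  exists m M : R, [/\ 0 < m, m <= M & forall x n,
    m * n%:R <= birkhoff_sum f (itinerary_control C x n) <= M * n%:R].
Proof.
move=> f_gt0; pose a i := birkhoff_sum f (ip_nu C i).
have a_gt0 i : 0 < a i.
  (* As tau >= 1, each control block has a first letter, which makes its sum strictly positive. *)
  rewrite /a /birkhoff_sum big_tuple; pose k := Ordinal (ip_tau_gt0 C).
  rewrite (bigD1 k)//= ltr_wpDr// sumr_ge0// => l _; exact: ltW.
have [i _ ai] := @Order.TotalTheory.arg_minP _ _ _ ord0 xpredT a isT.
have [k _ ak] := @Order.TotalTheory.arg_maxP _ _ _ ord0 xpredT a isT.
exists (a i), (a k); split=> [||x n]; [exact: a_gt0|exact: ak|].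
have sum_cst c : c * n%:R = \sum_(j < n) c.
  by rewrite sumr_const card_ord mulr_natr.
rewrite birkhoff_itinerary !sum_cst.
by apply/andP; split; apply: ler_sum => j _; [exact: ai|exact: ak].
Qed.

(** * Zeros of the masses in the (t, lambda) plane *)

Section Pressure.
Variables (phi : U -> R) (Z : set X) (m M : R).
Hypothesis m_gt0 : 0 < m.
Hypothesis mM : forall x n,
  m * n%:R <= birkhoff_sum phi (itinerary_control C x n) <= M * n%:R.

Local Notation tau := ((ip_tau C)%:R : R).
Local Notation P0 t l := (pressure_mass C (fun u => - t * phi u) Z l = 0%E).

Lemma bs_mass_pressure_mass t : bs_mass C phi Z t =
  pressure_mass C (fun u => - t * phi u) Z 0.
Proof.
congr (limn (cover_inf C _ Z)); apply/funext => x; apply/funext => n.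
by rewrite birkhoff_sumZ oppr0 mul0r add0r.
Qed.

(* A block contributes some c in [m, M] to the Birkhoff sum of phi; by
   linearity in c it suffices to compare the weights at both ends. *)
Lemma pressure_mass_transfer t l t' l' :
  (t - t') * m <= (l' - l) * tau -> (t - t') * M <= (l' - l) * tau ->
  P0 t l -> P0 t' l'.
Proof.
move=> hm hM; apply: le_lim_cover_inf_eq0 => x n.
rewrite !birkhoff_sumZ natrM.
have /andP[] := mM x n; set B := birkhoff_sum _ _ => mB BM.
have n0 : 0 <= n%:R :> R := ler0n R n.
suff : (t - t') * B <= (l' - l) * tau * n%:R by lra.
have [tt'|/ltW tt'] := lerP 0 (t - t').
  by apply: (le_trans (ler_wpM2l tt' BM)); rewrite mulrA ler_wpM2r.
by apply: (le_trans (ler_wnM2l tt' mB)); rewrite mulrA ler_wpM2r.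
Qed.

Lemma bs_mass_eq0_ge0 t : Z !=set0 -> bs_mass C phi Z t = 0%E -> 0 <= t.
Proof.
move=> Z0 /lim_cover_inf_eq0/(_ 0%N) le0; rewrite leNgt; apply/negP => t0.
suff : (1 <= 0 :> \bar R)%E by rewrite lee_fin ler10.
apply: le_trans (le0); apply: cover_inf_ge1 => // x n.
have /andP[mB _] := mM x n.
apply: mulr_ge0; first by rewrite oppr_ge0 ltW.
by apply: le_trans mB; rewrite mulr_ge0// ltW.
Qed.

Lemma bs_mass_eq0_exists : Z !=set0 -> Z `<=` Q ->
  exists t, bs_mass C phi Z t = 0%E.
Proof.
move=> Z0 ZQ; pose q : R := (ip_q C).+1%:R.
have q_gt0 : 0 < q by rewrite ltr0n.
exists (ln (2 * q) / m); apply/lim_cover_inf_eq0 => N.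
apply/lee_addgt0Pr => e e_gt0; rewrite add0e.
(* Chosen so that n >= N and n > 1/e, whence 2^n > n > 1/e. *)
pose n := maxn N (Num.truncn e^-1).+1.
apply: (le_trans (cover_inf_le_card (c := - ln (2 * q) * n%:R) C Z0 ZQ
  (leq_maxl N _ : (N <= n)%N) _)).
  move=> x; rewrite !mulNr lerN2; have /andP[mB _] := mM x n.
  apply: le_trans (ler_wpM2l _ mB); first by rewrite mulrA divfK// gt_eqF.
  by rewrite divr_ge0 ?ln_ge0 ?(ltW m_gt0)// -natrM ler1n.
(* The bound q^n (2q)^-n equals 2^-n. *)
rewrite lee_fin expRM_natr expRN lnK ?posrE ?mulr_gt0// natrX -exprMn.
rewrite invfM mulrCA divff ?gt_eqF// mulr1 exprVn.
rewrite invf_ple ?posrE ?exprn_gt0//.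
apply: le_trans (_ : n%:R <= _); last by rewrite -natrX ler_nat ltnW// ltn_expl.
apply: ltW; apply: (lt_le_trans (truncnS_gt _)); rewrite ler_nat.
exact: leq_maxr.
Qed.

Lemma pressure_le t l : P0 t l ->
  (pressure C (fun u => - t * phi u)%R Z <= l%:E)%E.
Proof. by move=> tl; apply: ereal_inf_lbound; exists l. Qed.

End Pressure.
End BirkhoffSum.

(** * Existence and uniqueness of the root *)

Theorem theorem1p3 (R : realType) (X U : metricType R)
  (compactU : compact [set: U])
  (F : X -> U -> X) (contF : forall u : U, continuous (fun x => F x u))
  (UU : set (nat -> U))
  (Q : set X) (invQ : controlled_invariant F UU Q)
  (C : invariant_partition F Q)
  (Z : set X) (Z0 : Z !=set0) (ZQ : Z `<=` Q)
  (phi : U -> R) (contphi : continuous phi)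
  (phi_gt0 : forall u : U, 0 < phi u) :
  exists t : R,
    [/\ bs_dimension C phi Z = t%:E,
        pressure C (fun u => - t * phi u) Z = 0%E &
        forall t' : R, pressure C (fun u => - t' * phi u) Z = 0%E -> t' = t].
Proof.
have [m [M [m_gt0 leM mM]]] := birkhoff_itinerary_bounds C phi_gt0.
have M_gt0 : 0 < M := lt_le_trans m_gt0 leM.
have tau_gt0 : 0 < (ip_tau C)%:R :> R by rewrite ltr0n ip_tau_gt0.
have transfer := pressure_mass_transfer (Z := Z) mM.
pose D := [set t : R | bs_mass C phi Z t = 0%E].
have DE t : D t <-> pressure_mass C (fun u => - t * phi u) Z 0 = 0%E.
  by rewrite -bs_mass_pressure_mass.
have D0 : D !=set0 := bs_mass_eq0_exists m_gt0 mM Z0 ZQ.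
have D_ge0 : lbound D 0 by move=> t; exact: (bs_mass_eq0_ge0 m_gt0 mM).
have D_lb : has_lbound D by exists 0.
set t0 := inf D; have D_inf t : D t -> t0 <= t by exact: ge_inf.
(* [D] is upward closed: [transfer] with lambda = 0 at both ends. *)
have D_gt t : t0 < t -> D t.
  move=> /(inf_lt D0)[s /DE Ds st]; apply/DE; apply: transfer Ds;
    by rewrite subrr mul0r nmulr_rle0 ?subr_lt0// ltW.
have dimE : bs_dimension C phi Z = t0%:E by exact: ereal_inf_EFin.
(* With these bodies visible, unification below unfolds [inf] and diverges. *)
clearbody t0 D.
(* Vanishing of the mass moves along the (t, lambda) plane: a decrease of t is
   paid for by an increase of lambda, and conversely. *)
have raise t l d e : 0 <= d -> d * M <= e * (ip_tau C)%:R ->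
    pressure_mass C (fun u => - t * phi u) Z l = 0%E ->
    pressure_mass C (fun u => - (t - d) * phi u) Z (l + e) = 0%E.
  move=> d_ge0 dMe tl.
  have dd : t - (t - d) = d by ring.
  have ee : l + e - l = e by ring.
  apply: transfer tl; rewrite dd ee //.
  (* As d >= 0, the condition with [M] implies the one with [m]; for [lower] the signs flip and [m]
     is the binding one. *)
  exact: le_trans (ler_wpM2l d_ge0 leM) dMe.
have lower t l d e : 0 <= d -> e * (ip_tau C)%:R <= d * m ->
    pressure_mass C (fun u => - t * phi u) Z l = 0%E ->
    pressure_mass C (fun u => - (t + d) * phi u) Z (l - e) = 0%E.
  move=> d_ge0 edm tl.
  have dd : t - (t + d) = - d by ring.
  have ee : l - e - l = - e by ring.
  apply: transfer tl; rewrite dd ee !mulNr lerN2//.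
  exact: le_trans edm (ler_wpM2l d_ge0 leM).
exists t0; split=> //.
- apply/eqP; rewrite eq_le; apply/andP; split.
    (* For each l > 0, going back from t0 + d in [D] to [t0] raises lambda from 0 to [l]. *)
    apply/lee_addgt0Pr => l l_gt0; rewrite add0e; apply: pressure_le.
    pose d := l * (ip_tau C)%:R / M.
    have d_gt0 : 0 < d by rewrite divr_gt0// mulr_gt0.
    have dM : d * M <= l * (ip_tau C)%:R by rewrite divfK// gt_eqF.
    have /D_gt/DE Dd : t0 < t0 + d by rewrite ltrDl.
    by have := raise _ _ _ _ (ltW d_gt0) dM Dd; rewrite addrK add0r.
  (* A zero of the mass at some l < 0 would put t0 - d in [D], below its infimum. *)
  apply/ereal_infP => _ [l /= tl <-]; rewrite lee_fin leNgt; apply/negP => l_lt0.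
  pose d := - l * (ip_tau C)%:R / M.
  have d_gt0 : 0 < d by rewrite divr_gt0// mulr_gt0// oppr_gt0.
  have dM : d * M <= - l * (ip_tau C)%:R by rewrite divfK// gt_eqF.
  have := raise _ _ _ _ (ltW d_gt0) dM tl; rewrite (subrr l) => /(proj2 (DE _))/D_inf.
  by rewrite lerBrDr gerDl leNgt d_gt0.
- move=> t' Pt'; apply/eqP; rewrite eq_le; apply/andP; split;
    rewrite leNgt; apply/negP => tt.
    (* The midpoint t' - d lies in [D]; the other half of the gap brings lambda down to -e, so the
       pressure at [t'] would be negative. *)
    pose d := (t' - t0) / 2.
    have d_gt0 : 0 < d by rewrite divr_gt0// subr_gt0.
    pose e := d * m / (ip_tau C)%:R.
    have e_gt0 : 0 < e by rewrite divr_gt0// mulr_gt0.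
    have ed : e * (ip_tau C)%:R <= d * m by rewrite divfK// gt_eqF.
    have /D_gt/DE Dd : t0 < t' - d by rewrite /d; lra.
    have := lower _ _ _ _ (ltW d_gt0) ed Dd; rewrite (subrK d) (sub0r e) => /pressure_le.
    by rewrite Pt' lee_fin oppr_ge0 leNgt e_gt0.
  (* Zero pressure at [t'] gives a zero of the mass at some l < e; moving to the midpoint t' + d
     absorbs [l] and yields an element of [D] below [t0]. *)
  pose d := (t0 - t') / 2.
  have d_gt0 : 0 < d by rewrite divr_gt0// subr_gt0.
  pose e := d * m / (ip_tau C)%:R.
  have e_gt0 : 0 < e by rewrite divr_gt0// mulr_gt0.
  have ed : e * (ip_tau C)%:R = d * m by rewrite divfK// gt_eqF.
  have : (pressure C (fun u => - t' * phi u)%R Z < e%:E)%E by rewrite Pt' lte_fin.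
  case/ereal_inf_lt => _ [l /= tl <-]; rewrite lte_fin => le.
  have ld : l * (ip_tau C)%:R <= d * m by rewrite -ed ler_wpM2r ?ltW.
  have := lower _ _ _ _ (ltW d_gt0) ld tl; rewrite (subrr l) => /(proj2 (DE _))/D_inf.
  by rewrite /d; lra.
Qed.
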